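(* Suppose that $f(z)=\sum_{k=0}^\infty a_kz^k$ is an analytic function in $\mathbb{D}$ with $|f(z)|<1$ for all $z\in\mathbb{D}$, and let $a=|a_0|$, so $0\le a<1$. If $a\ge 2\sqrt3-3$, then $$|f(z)|+\sum_{k=1}^\infty |a_k|r^k\le 1$$ for all $|z|=r\le r_a$, where $$r_a=\frac{\sqrt{(1+a)^2+a^2}-(1+a)}{a^2}=\frac{1}{\sqrt{(1+a)^2+a^2}+1+a}.$$ The radius $r_a$ is sharp, i.e. for each $a\in[2\sqrt3-3,1)$ the number $r_a$ cannot be replaced by any larger number so that the inequality remains true for all such $f$ with $|a_0|=a$.
   Context: $\mathbb{D}=\{z\in\mathbb{C}:|z|<1\}$. *)

(* Defs.v *)
From Stdlib Require Import Reals.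
From Coquelicot Require Import Coquelicot.
Open Scope R_scope.

(* [c] is the sequence of Taylor coefficients at 0 of [f]; convergence of the
   complex power series to [f z] at every point of the open unit disk is what
   makes [f] analytic there. Values of [f] outside the disk are irrelevant. *)
Definition analytic_in_disk (f : C -> C) (c : nat -> C) : Prop :=
  forall z : C, Cmod z < 1 ->
    is_pseries (K := C_AbsRing) (V := C_NormedModule) c z (f z).

Definition maps_disk_into_disk (f : C -> C) : Prop :=
  forall z : C, Cmod z < 1 -> Cmod (f z) < 1.

(* Convergence is asserted because [Series] is a total function. The sum runs
   over k >= 1, hence the index shift. *)
Definition bohr_rogosinski_at (f : C -> C) (c : nat -> C) (z : C) : Prop :=
  let u := fun k : nat => Cmod (c (S k)) * Cmod z ^ S k in
  ex_series u /\ Cmod (f z) + Series u <= 1.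

(* [f] lives on the unit disk only, so a radius [rho >= 1] means the whole
   disk. *)
Definition bohr_rogosinski_upto
    (f : C -> C) (c : nat -> C) (rho : R) : Prop :=
  forall z : C, Cmod z < 1 -> Cmod z <= rho -> bohr_rogosinski_at f c z.

Definition bohr_radius (a : R) : R :=
  (sqrt ((1 + a) ^ 2 + a ^ 2) - (1 + a)) / a ^ 2.

(* Main.v *)
Require Import Defs.
From Stdlib Require Import Reals Arith Lra Lia.
From Coquelicot Require Import Coquelicot.
Open Scope R_scope.

(* Averaging over roots of unity gives Parseval's identity for polynomials.
   Parseval bounds the coefficients, and applied to powers it yields the maximum
   modulus principle, hence the Schwarz-Pick inequality
   [|P(z) - c0| <= |z| |1 - conj c0 P(z)|] for polynomials bounded by 1.
   With [a = |c0|], this inequality bounds [|P(z)|] by [(a + r) / (1 + a r)];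
   integrated over a circle of radius [t] it bounds
   [sum_{k >= 1} |c_k|^2 t^(2k)], and Cauchy-Schwarz with [t^2 = r / a] turns that
   into [sum_{k >= 1} |c_k| r^k <= (1 - a^2) r / (1 - a r)] for [r < a].
   The two bounds add up to at most 1 exactly when
   [a^2 r^2 + 2 (1 + a) r <= 1], that is, when [r <= r_a]; they pass to analytic
   functions through dilated Taylor polynomials, and both are attained by
   [(a - z) / (1 - a z)] at [z = -r]. *)

(** * Finite sums, geometric sums and elementary modulus estimates *)

Lemma sumR_S (u : nat -> R) (n : nat) : sum_n u (S n) = sum_n u n + u (S n) :> R.
Proof. exact (sum_Sn u n). Qed.

Lemma sumC_S (u : nat -> C) (n : nat) :
  sum_n u (S n) = (sum_n u n + u (S n))%C :> C.
Proof. exact (sum_Sn u n). Qed.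

Lemma sumR_ext (u v : nat -> R) (n : nat) :
  (forall k, u k = v k) -> sum_n u n = sum_n v n :> R.
Proof. exact (sum_n_ext u v n). Qed.

Lemma sumC_ext (u v : nat -> C) (n : nat) :
  (forall k, u k = v k) -> sum_n u n = sum_n v n :> C.
Proof. exact (sum_n_ext u v n). Qed.

Lemma sumC_mult_l (x : C) (u : nat -> C) (n : nat) :
  sum_n (fun k => (x * u k)%C) n = (x * sum_n u n)%C.
Proof. exact (sum_n_mult_l (K := C_Ring) x u n). Qed.

Lemma Cmod_sum_n (u : nat -> C) (n : nat) :
  Cmod (sum_n u n) <= sum_n (fun k => Cmod (u k)) n.
Proof.
exact (norm_sum_n_m (K := C_AbsRing) (V := C_NormedModule) u 0 n).
Qed.

Lemma sum_n_le_loc (u v : nat -> R) (n : nat) :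
  (forall k, (k <= n)%nat -> u k <= v k) -> sum_n u n <= sum_n v n.
Proof.
induction n as [|n IH]; intros H.
- rewrite !sum_O. apply H; lia.
- rewrite !sumR_S. apply Rplus_le_compat; [apply IH; intros; apply H; lia|apply H; lia].
Qed.

Lemma sum_n_nonneg (u : nat -> R) (n : nat) :
  (forall k, 0 <= u k) -> 0 <= sum_n u n.
Proof.
intros H. induction n as [|n IH].
- rewrite sum_O. apply H.
- rewrite sumR_S. specialize (H (S n)). lra.
Qed.

Lemma sum_n_ge_term (u : nat -> R) (n k : nat) :
  (forall k, 0 <= u k) -> (k <= n)%nat -> u k <= sum_n u n.
Proof.
intros H. induction n as [|n IH]; intros Hk.
- rewrite sum_O. replace k with 0%nat by lia. lra.
- rewrite sumR_S. destruct (Nat.eq_dec k (S n)) as [->|Hne].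
  + pose proof (sum_n_nonneg u n H). lra.
  + specialize (H (S n)). assert (u k <= sum_n u n) by (apply IH; lia). lra.
Qed.

Lemma sum_n_scal (x : R) (u : nat -> R) (n : nat) :
  sum_n (fun k => x * u k) n = x * sum_n u n.
Proof. exact (sum_n_mult_l (K := R_Ring) x u n). Qed.

Lemma sum_n_add (u v : nat -> R) (n : nat) :
  sum_n (fun k => u k + v k) n = sum_n u n + sum_n v n.
Proof. exact (sum_n_plus (G := R_AbelianMonoid) u v n). Qed.

Lemma sum_n_head (u : nat -> R) (n : nat) :
  sum_n u (S n) = u 0%nat + sum_n (fun k => u (S k)) n :> R.
Proof.
induction n as [|n IH].
- rewrite sumR_S, !sum_O. reflexivity.
- rewrite sumR_S, IH, (sumR_S (fun k => u (S k))). ring.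
Qed.

Lemma sum_geomC (x : C) (n : nat) :
  ((1 - x) * sum_n (fun k => x ^ k)%C n)%C = (1 - x ^ S n)%C.
Proof.
induction n as [|n IH].
- rewrite sum_O. simpl. ring.
- rewrite sumC_S, Cmult_plus_distr_l, IH. simpl. ring.
Qed.

Lemma sum_geomR (x : R) (n : nat) :
  (1 - x) * sum_n (fun k => x ^ k) n = 1 - x ^ S n.
Proof.
induction n as [|n IH].
- rewrite sum_O. simpl. ring.
- rewrite sumR_S, Rmult_plus_distr_l, IH. simpl. ring.
Qed.

Lemma sum_geomR_le (x : R) (n : nat) :
  0 <= x < 1 -> sum_n (fun k => x ^ k) n <= / (1 - x).
Proof.
intros Hx. apply Rmult_le_reg_l with (1 - x); [lra|].
rewrite sum_geomR, Rinv_r by lra.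
assert (0 <= x ^ S n) by (apply pow_le; lra). lra.
Qed.

(** Removes a constant factor from an estimate that is valid for all powers: for [x > 1] the powers
    would exceed every [M]. *)
Lemma bounded_powers_le_1 (x M : R) :
  0 <= x -> (forall n, x ^ n <= M) -> x <= 1.
Proof.
intros Hx H. destruct (Rle_or_lt x 1) as [?|H1]; [assumption|exfalso].
destruct (Pow_x_infinity x) with (b := M + 1) as [N HN].
- rewrite Rabs_pos_eq; lra.
- specialize (HN N (le_n N)). specialize (H N).
  rewrite Rabs_pos_eq in HN by (apply pow_le; lra). lra.
Qed.

Lemma powers_small (x eps : R) :
  0 <= x < 1 -> 0 < eps -> exists n, x ^ S n < eps.
Proof.
intros Hx He. destruct (pow_lt_1_zero x) with (y := eps) as [N HN].
- rewrite Rabs_pos_eq; lra.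
- lra.
- exists N. specialize (HN (S N) ltac:(lia)).
  rewrite Rabs_pos_eq in HN by (apply pow_le; lra). exact HN.
Qed.

Lemma Cmod_plus_sqr (x y : C) :
  Cmod (x + y) ^ 2 = Cmod x ^ 2 + Cmod y ^ 2 + 2 * Re (x * Cconj y).
Proof.
rewrite !Cmod2_alt. destruct x as [a b], y as [c d]. simpl. ring.
Qed.

Lemma Cmod_sub_ge (x y : C) : Cmod x - Cmod y <= Cmod (x - y).
Proof.
pose proof (Cmod_triangle (x - y) y) as H.
replace (x - y + y)%C with x in H by ring. lra.
Qed.

Lemma Cmod_one_minus_ge (x : C) : 1 - Cmod x <= Cmod (1 - x).
Proof. rewrite <- Cmod_1 at 1. apply Cmod_sub_ge. Qed.

Lemma Cmod_one_minus_le (x : C) : Cmod (1 - x) <= 1 + Cmod x.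
Proof.
pose proof (Cmod_triangle 1 (- x)) as H.
rewrite Cmod_1, Cmod_opp in H. exact H.
Qed.

(** * Roots of unity and Parseval's identity *)

Lemma Cpow_cos_sin (t : R) (k : nat) :
  ((cos t, sin t) ^ k)%C = (cos (INR k * t), sin (INR k * t)).
Proof.
induction k as [|k IH].
- rewrite Rmult_0_l, cos_0, sin_0. reflexivity.
- rewrite Cpow_S, IH, S_INR.
  replace ((INR k + 1) * t) with (t + INR k * t) by ring.
  rewrite cos_plus, sin_plus. unfold Cmult. simpl. f_equal; ring.
Qed.

Lemma primitive_root_exists (M : nat) :
  exists w : C, Cmod w = 1 /\ (w ^ S M)%C = 1 /\
    forall k, (0 < k <= M)%nat -> (w ^ k)%C <> 1.
Proof.
set (N := INR (S M)).
assert (HN : 0 < N) by (apply lt_0_INR; lia).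
pose proof PI_RGT_0 as Hpi.
exists (cos (2 * PI / N), sin (2 * PI / N)). split; [|split].
- rewrite <- (Rabs_pos_eq (Cmod _)) by apply Cmod_ge_0.
  rewrite <- (Rabs_pos_eq 1) by lra.
  apply Rsqr_eq_abs_0. rewrite !Rsqr_pow2, Cmod2_alt. simpl Re; simpl Im.
  rewrite <- !Rsqr_pow2, Rplus_comm, sin2_cos2. unfold Rsqr; ring.
- rewrite Cpow_cos_sin. fold N.
  replace (N * (2 * PI / N)) with (2 * PI) by (field; lra).
  rewrite cos_2PI, sin_2PI. reflexivity.
- intros k Hk. rewrite Cpow_cos_sin. intros E.
  apply (f_equal fst) in E. simpl in E.
  assert (Hk0 : 0 < INR k) by (apply lt_0_INR; lia).
  assert (HkN : INR k < N) by (apply lt_INR; lia).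
  (* Half the angle of [w ^ k]: since [cos (2 * h) = 1 - 2 * sin h * sin h], the value 1 would force
     [sin h = 0], impossible for [0 < h < PI]. *)
  set (h := INR k * PI / N).
  assert (Hh : 0 < h < PI).
  { split; unfold h.
    - apply Rdiv_lt_0_compat; nra.
    - apply Rmult_lt_reg_r with N; [lra|]. unfold Rdiv.
      rewrite Rmult_assoc, Rinv_l by lra. nra. }
  replace (INR k * (2 * PI / N)) with (2 * h) in E by (unfold h; field; lra).
  rewrite cos_2a_sin in E.
  assert (0 < sin h) by (apply sin_gt_0; lra). nra.
Qed.

(** A geometric sum of ratio [w ^ k]: multiplied by the nonzero [1 - w ^ k] it becomes
    [1 - (w ^ k) ^ S M = 0]. *)
Lemma root_of_unity_sum (w : C) (M k : nat) :
  (w ^ S M)%C = 1 -> (w ^ k)%C <> 1 ->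
  sum_n (fun j => ((w ^ j) ^ k)%C) M = RtoC 0 :> C.
Proof.
intros Hw Hk.
rewrite (sumC_ext _ (fun j => ((w ^ k) ^ j)%C))
  by (intros j; rewrite <- !Cpow_mult_r, Nat.mul_comm; reflexivity).
pose proof (sum_geomC (w ^ k) M) as H.
rewrite <- Cpow_mult_r, Nat.mul_comm, Cpow_mult_r, Hw, Cpow_1_l in H.
destruct (Ceq_dec (sum_n (fun j => ((w ^ k) ^ j)%C) M) 0) as [E|E]; [exact E|].
exfalso. assert (H1 : (1 - w ^ k)%C <> 0).
{ apply Cminus_eq_contra. congruence. }
apply (Cmult_neq_0 _ _ H1 E). rewrite H. ring.
Qed.

(** The degree bound [n] is inclusive and separate from [c], so the truncations of a power series
    all share its coefficient sequence. *)
Definition polyval (c : nat -> C) (n : nat) (z : C) : C :=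
  sum_n (fun k => (c k * z ^ k)%C) n.

Lemma polyval_S (c : nat -> C) (n : nat) (z : C) :
  polyval c (S n) z = (polyval c n z + c (S n) * z ^ S n)%C.
Proof. apply sumC_S. Qed.

Lemma polyval_0 (c : nat -> C) (n : nat) : polyval c n 0 = c 0%nat.
Proof.
induction n as [|n IH].
- unfold polyval. rewrite sum_O. simpl. ring.
- rewrite polyval_S, IH. simpl. ring.
Qed.

Lemma polyval_head (c : nat -> C) (n : nat) (z : C) :
  polyval c (S n) z = (c 0%nat + z * polyval (fun k => c (S k)) n z)%C.
Proof.
induction n as [|n IH].
- rewrite polyval_S. unfold polyval. rewrite !sum_O. simpl. ring.
- rewrite polyval_S, IH, polyval_S, (Cpow_S z (S n)). ring.
Qed.

Lemma Cmod_polyval_le (c : nat -> C) (n : nat) (z : C) :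
  Cmod (polyval c n z) <= sum_n (fun k => Cmod (c k) * Cmod z ^ k) n.
Proof.
eapply Rle_trans; [apply Cmod_sum_n|].
apply Req_le, sumR_ext. intros k. rewrite Cmod_mult, Cmod_pow. reflexivity.
Qed.

(** On the unit circle conjugation is inversion, so the monomial of degree [k] contributes the
    conjugate of a sum of powers [(w ^ j) ^ (m - k)]. It vanishes because [0 < m - k <= M]. *)
Lemma root_of_unity_orthogonal (c : nat -> C) (w : C) (M n m : nat) :
  Cmod w = 1 -> (w ^ S M)%C = 1 ->
  (forall k, (0 < k <= M)%nat -> (w ^ k)%C <> 1) ->
  (n < m <= M)%nat ->
  sum_n (fun j => (Cconj ((w ^ j) ^ m) * polyval c n (w ^ j))%C) M = RtoC 0 :> C.
Proof.
intros Hw1 HwM Hw Hnm.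
assert (Hc : (w * Cconj w)%C = 1).
{ rewrite <- Cmod2_conj, Hw1. f_equal. ring. }
assert (Hterm : forall k, (k < m)%nat ->
  sum_n (fun j => (Cconj ((w ^ j) ^ m) * (c k * (w ^ j) ^ k))%C) M = RtoC 0 :> C).
{ intros k Hk. 
  rewrite (sumC_ext _ (fun j => (c k * Cconj ((w ^ j) ^ (m - k)))%C)).
  - rewrite (sumC_mult_l (c k)).
    assert (H0 : Cconj (sum_n (fun j => ((w ^ j) ^ (m - k))%C) M) = 0).
    { rewrite root_of_unity_sum by (try exact HwM; apply Hw; lia).
      unfold Cconj. simpl. rewrite Ropp_0. reflexivity. }
    assert (Hs : forall (u : nat -> C) p,
      sum_n (fun j => Cconj (u j)) p = Cconj (sum_n u p) :> C).
    { intros u p. induction p as [|p IH]; [rewrite !sum_O; reflexivity|].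
      rewrite !sumC_S, IH, Cplus_conj. reflexivity. }
    rewrite (Hs (fun j => ((w ^ j) ^ (m - k))%C)), H0. ring.
  - intros j. replace m with ((m - k) + k)%nat at 1 by lia.
    rewrite Cpow_add_r, Cmult_conj, (Cpow_conj (w ^ j) k).
    replace (Cconj ((w ^ j) ^ (m - k)) * Cconj (w ^ j) ^ k * (c k * (w ^ j) ^ k))%C
      with (c k * Cconj ((w ^ j) ^ (m - k)) * (w ^ j * Cconj (w ^ j)) ^ k)%C
      by (rewrite (Cpow_mult_l (w ^ j) (Cconj (w ^ j)) k); ring).
    rewrite (Cpow_conj w j), <- Cpow_mult_l, Hc, !Cpow_1_l. ring. }
assert (Hle : (n < m)%nat) by lia. clear Hnm.
induction n as [|n IH].
- unfold polyval.
  rewrite (sumC_ext _ (fun j => (Cconj ((w ^ j) ^ m) * (c 0%nat * (w ^ j) ^ 0))%C))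
    by (intros j; rewrite sum_O; reflexivity).
  apply Hterm. lia.
- rewrite (sumC_ext _ (fun j => (Cconj ((w ^ j) ^ m) * polyval c n (w ^ j)
     + Cconj ((w ^ j) ^ m) * (c (S n) * (w ^ j) ^ S n))%C))
    by (intros j; rewrite polyval_S; ring).
  etransitivity; [exact (sum_n_plus (G := C_AbelianMonoid) _ _ M)|].
  rewrite IH, Hterm by lia. apply Cplus_0_l.
Qed.

(** Induction on the degree: adding the top term to the polynomial creates a cross term, which
    orthogonality to all lower degrees kills. The factor [INR (S M)] counts the nodes [w ^ 0], ...,
    [w ^ M]. *)
Lemma parseval_roots_of_unity (c : nat -> C) (w : C) (M n : nat) :
  Cmod w = 1 -> (w ^ S M)%C = 1 ->
  (forall k, (0 < k <= M)%nat -> (w ^ k)%C <> 1) ->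
  (n <= M)%nat ->
  sum_n (fun j => Cmod (polyval c n (w ^ j)) ^ 2) M =
  INR (S M) * sum_n (fun k => Cmod (c k) ^ 2) n.
Proof.
intros Hw1 HwM Hw. induction n as [|n IH]; intros Hn.
- rewrite sum_O.
  rewrite (sumR_ext _ (fun _ => Cmod (c 0%nat) ^ 2)).
  + apply sum_n_const.
  + intros j. unfold polyval. rewrite sum_O. do 2 f_equal. simpl. ring.
- rewrite sumR_S, Rmult_plus_distr_l, <- IH by lia.
  rewrite (sumR_ext _ (fun j => (Cmod (polyval c n (w ^ j)) ^ 2
    + Cmod (c (S n)) ^ 2) + 2 * Re (Cconj (c (S n)) *
        (Cconj ((w ^ j) ^ S n) * polyval c n (w ^ j))))).
  + rewrite sum_n_add, sum_n_add, sum_n_const, sum_n_scal.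
    assert (HRe : forall (u : nat -> C) p,
      sum_n (fun j => Re (u j)) p = Re (sum_n u p) :> R).
    { intros u p. induction p as [|p IHp]; [rewrite !sum_O; reflexivity|].
      rewrite sumR_S, sumC_S, IHp, re_plus. reflexivity. }
    rewrite HRe, sumC_mult_l, root_of_unity_orthogonal by (assumption || lia).
    rewrite Cmult_0_r. simpl. ring.
  + intros j. rewrite polyval_S, Cmod_plus_sqr, Cmod_mult, !Cmod_pow, Hw1, !pow1.
    rewrite Cmult_conj, Rmult_1_r. do 3 f_equal. ring.
Qed.

(** Comparing two polynomials lets one statement serve both the coefficient bound, where [d] is
    constant, and the Schwarz-Pick inequality, where both sides vary. *)
Lemma parseval_le (c d : nat -> C) (n : nat) (K : R) :
  (forall z, Cmod z = 1 -> Cmod (polyval c n z) <= K * Cmod (polyval d n z)) ->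
  sum_n (fun k => Cmod (c k) ^ 2) n <= K ^ 2 * sum_n (fun k => Cmod (d k) ^ 2) n.
Proof.
intros H. destruct (primitive_root_exists n) as [w [Hw1 [HwM Hw]]].
assert (Hn : 0 < INR (S n)) by (apply lt_0_INR; lia).
apply Rmult_le_reg_l with (INR (S n)); [exact Hn|].
rewrite <- (parseval_roots_of_unity c w n n) by (assumption || lia).
replace (INR (S n) * (K ^ 2 * sum_n (fun k => Cmod (d k) ^ 2) n)) with
  (K ^ 2 * (INR (S n) * sum_n (fun k => Cmod (d k) ^ 2) n)) by ring.
rewrite <- (parseval_roots_of_unity d w n n) by (assumption || lia).
rewrite <- sum_n_scal. apply sum_n_le_loc. intros j _.
rewrite <- Rpow_mult_distr. apply pow_incr. split; [apply Cmod_ge_0|].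
apply H. rewrite Cmod_pow, Hw1. apply pow1.
Qed.

(** Parseval comparison with the constant polynomial 1; a single square is at most the whole sum of
    squares. *)
Lemma coefficient_le (c : nat -> C) (n k : nat) (B : R) :
  (forall z, Cmod z = 1 -> Cmod (polyval c n z) <= B) ->
  (k <= n)%nat -> Cmod (c k) <= B.
Proof.
intros H Hk.
assert (HB : 0 <= B).
{ eapply Rle_trans; [apply Cmod_ge_0|apply (H 1), Cmod_1]. }
set (d := fun k : nat => if Nat.eq_dec k 0 then RtoC 1 else RtoC 0).
assert (Hd : forall m z, polyval d m z = 1).
{ intros m z. induction m as [|m IH].
  - unfold polyval. rewrite sum_O. unfold d. simpl. ring.
  - rewrite polyval_S, IH. unfold d. simpl. ring. }
assert (Hd2 : sum_n (fun k => Cmod (d k) ^ 2) n = 1).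
{ induction n as [|m IH] in |- *.
  - rewrite sum_O. unfold d. simpl. rewrite Cmod_1. ring.
  - rewrite sumR_S, IH. unfold d. simpl. rewrite Cmod_0. ring. }
pose proof (parseval_le c d n B) as Hp. rewrite Hd2, Rmult_1_r in Hp.
apply Rsqr_incr_0_var; [|exact HB]. rewrite !Rsqr_pow2.
eapply Rle_trans; [|apply Hp].
- apply (sum_n_ge_term (fun k => Cmod (c k) ^ 2)); [|exact Hk].
  intros j. apply pow2_ge_0.
- intros z Hz. rewrite Hd, Cmod_1, Rmult_1_r. apply H, Hz.
Qed.

(** * Algebra of polynomial functions and the maximum modulus principle *)

Definition polynomial (g : C -> C) : Prop :=
  exists (c : nat -> C) (n : nat), forall z, g z = polyval c n z.

Lemma polynomial_ext (g h : C -> C) :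
  (forall z, g z = h z) -> polynomial g -> polynomial h.
Proof.
intros E [c [n H]]. exists c, n. intros z. rewrite <- E. apply H.
Qed.

Lemma polynomial_polyval (c : nat -> C) (n : nat) : polynomial (polyval c n).
Proof. exists c, n. reflexivity. Qed.

Lemma polynomial_const (x : C) : polynomial (fun _ => x).
Proof.
exists (fun _ => x), 0%nat. intros z. unfold polyval. rewrite sum_O. simpl. ring.
Qed.

(** Padding with zeros gives two polynomials a common length, so that they can be added termwise. *)
Lemma polyval_pad (c : nat -> C) (n m : nat) (z : C) :
  polyval (fun k => if le_dec k n then c k else RtoC 0) (n + m) z = polyval c n z.
Proof.
induction m as [|m IH].
- rewrite Nat.add_0_r. apply sum_n_ext_loc. intros k Hk.
  destruct (le_dec k n); [reflexivity|lia].
- rewrite Nat.add_succ_r, polyval_S, IH.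
  destruct (le_dec (S (n + m)) n); [lia|ring].
Qed.

Lemma polynomial_plus (g h : C -> C) :
  polynomial g -> polynomial h -> polynomial (fun z => (g z + h z)%C).
Proof.
intros [c [n Hg]] [d [m Hh]].
exists (fun k => ((if le_dec k n then c k else RtoC 0)
                + (if le_dec k m then d k else RtoC 0))%C), (n + m)%nat.
intros z. rewrite Hg, Hh, <- (polyval_pad c n m z), <- (polyval_pad d m n z).
rewrite (Nat.add_comm m n). unfold polyval.
etransitivity; [symmetry; exact (sum_n_plus (G := C_AbelianMonoid) _ _ (n + m))|].
apply sumC_ext. intros k. change plus with Cplus. ring.
Qed.

Lemma polynomial_scal (x : C) (g : C -> C) :
  polynomial g -> polynomial (fun z => (x * g z)%C).
Proof.
intros [c [n Hg]]. exists (fun k => (x * c k)%C), n. intros z.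
rewrite Hg. unfold polyval. rewrite <- sumC_mult_l. apply sumC_ext.
intros k. ring.
Qed.

Lemma polynomial_shift (g : C -> C) :
  polynomial g -> polynomial (fun z => (z * g z)%C).
Proof.
intros [c [n Hg]].
exists (fun k => match k with O => RtoC 0 | S k => c k end), (S n).
intros z. rewrite polyval_head, Hg, Cplus_0_l. reflexivity.
Qed.

(** Splitting the first factor as [c 0 + z * Q(z)], as in Horner's scheme, reduces products to sums,
    scalings and shifts, with no convolution of coefficients. *)
Lemma polynomial_mult (g h : C -> C) :
  polynomial g -> polynomial h -> polynomial (fun z => (g z * h z)%C).
Proof.
intros [c [n Hg]] Hh.
apply polynomial_ext with (fun z => (polyval c n z * h z)%C).
{ intros z. rewrite Hg. reflexivity. }
clear g Hg. revert c. induction n as [|n IH]; intros c.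
- apply polynomial_ext with (fun z => (c 0%nat * h z)%C).
  + intros z. unfold polyval. rewrite sum_O. simpl. ring.
  + apply polynomial_scal, Hh.
- apply polynomial_ext with
    (fun z => (c 0%nat * h z + z * (polyval (fun k => c (S k)) n z * h z))%C).
  + intros z. rewrite polyval_head. ring.
  + apply polynomial_plus; [apply polynomial_scal, Hh|].
    apply polynomial_shift, IH.
Qed.

Lemma polynomial_pow (g : C -> C) (m : nat) :
  polynomial g -> polynomial (fun z => (g z ^ m)%C).
Proof.
intros Hg. induction m as [|m IH].
- apply (polynomial_const 1).
- apply (polynomial_mult _ _ Hg IH).
Qed.

Lemma polynomial_sum_n (g : nat -> C -> C) (m : nat) :
  (forall j, polynomial (g j)) -> polynomial (fun z => sum_n (fun j => g j z) m).
Proof.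
intros Hg. induction m as [|m IH].
- apply polynomial_ext with (g 0%nat); [|apply Hg].
  intros z. rewrite sum_O. reflexivity.
- apply polynomial_ext with (fun z => (sum_n (fun j => g j z) m + g (S m) z)%C).
  + intros z. rewrite sumC_S. reflexivity.
  + apply polynomial_plus; [exact IH|apply Hg].
Qed.

(* The coefficients of [g ^ m] are bounded by [1], so [g w ^ m] is bounded
   independently of [m]. *)
Lemma polynomial_max_modulus_1 (g : C -> C) (w : C) :
  polynomial g -> (forall z, Cmod z = 1 -> Cmod (g z) <= 1) ->
  Cmod w < 1 -> Cmod (g w) <= 1.
Proof.
intros Hg H Hw. pose proof (Cmod_ge_0 w) as Hw0.
apply bounded_powers_le_1 with (/ (1 - Cmod w)); [apply Cmod_ge_0|].
intros m. destruct (polynomial_pow g m Hg) as [c [n Hc]].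
rewrite <- Cmod_pow, Hc.
eapply Rle_trans; [apply Cmod_polyval_le|].
eapply Rle_trans; [|apply (sum_geomR_le (Cmod w) n); lra].
apply sum_n_le_loc. intros k Hk.
rewrite <- (Rmult_1_l (Cmod w ^ k)) at 2.
apply Rmult_le_compat_r; [apply pow_le, Hw0|].
apply (coefficient_le c n k); [|exact Hk].
intros z Hz. rewrite <- Hc, Cmod_pow, <- (pow1 m).
apply pow_incr. split; [apply Cmod_ge_0|apply H, Hz].
Qed.

(** Division by [B] reduces to the bound 1; on the circle itself the hypothesis applies directly. *)
Lemma polynomial_max_modulus (g : C -> C) (B : R) (w : C) :
  polynomial g -> 0 < B -> (forall z, Cmod z = 1 -> Cmod (g z) <= B) ->
  Cmod w <= 1 -> Cmod (g w) <= B.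
Proof.
intros Hg HB H [Hw|Hw]; [|apply H, Hw].
assert (Hscal : forall z, Cmod (/ B * g z) = / B * Cmod (g z)).
{ intros z. rewrite Cmod_mult, <- RtoC_inv, Cmod_R by lra.
  rewrite Rabs_pos_eq; [reflexivity|]. left. apply Rinv_0_lt_compat, HB. }
apply Rmult_le_reg_l with (/ B); [apply Rinv_0_lt_compat, HB|].
rewrite Rinv_l, <- Hscal by lra.
apply (polynomial_max_modulus_1 (fun z => (/ B * g z)%C)); [|intros z Hz|exact Hw].
- apply polynomial_scal, Hg.
- rewrite Hscal. apply Rmult_le_reg_l with B; [exact HB|].
  rewrite <- Rmult_assoc, Rinv_r by lra. rewrite Rmult_1_l, Rmult_1_r. apply H, Hz.
Qed.

(** * The Schwarz-Pick inequality for polynomials *)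

Lemma Cmod_conj_mult (x y : C) : Cmod (Cconj x * y) = Cmod x * Cmod y.
Proof. rewrite Cmod_mult, Cmod_conj. reflexivity. Qed.

(** Measures how far [(y - x) / (1 - conj x * y)] is from the unit circle; it serves the boundary
    estimate, the growth bound and the extremal function. *)
Lemma schwarz_pick_identity (x y : C) :
  Cmod (1 - Cconj x * y) ^ 2 =
  Cmod (y - x) ^ 2 + (1 - Cmod x ^ 2) * (1 - Cmod y ^ 2).
Proof.
rewrite !Cmod2_alt. destruct x as [a b], y as [c d]. simpl. ring.
Qed.

Lemma schwarz_pick_denominator_pos (x y : C) :
  Cmod x < 1 -> Cmod y <= 1 -> 0 < Cmod (1 - Cconj x * y).
Proof.
intros Hx Hy. pose proof (Cmod_one_minus_ge (Cconj x * y)) as H.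
rewrite Cmod_conj_mult in H. pose proof (Cmod_ge_0 x). pose proof (Cmod_ge_0 y). nra.
Qed.

Lemma schwarz_pick_boundary (x y : C) :
  Cmod x <= 1 -> Cmod y <= 1 -> Cmod (y - x) <= Cmod (1 - Cconj x * y).
Proof.
intros Hx Hy. apply Rsqr_incr_0_var; [|apply Cmod_ge_0].
rewrite !Rsqr_pow2, schwarz_pick_identity.
pose proof (Cmod_ge_0 x). pose proof (Cmod_ge_0 y).
assert (0 <= (1 - Cmod x ^ 2) * (1 - Cmod y ^ 2)) by (apply Rmult_le_pos; nra). lra.
Qed.

Lemma polynomial_divide_X (c : nat -> C) (n : nat) :
  exists q, polynomial q /\ forall z, polyval c n z = (c 0%nat + z * q z)%C.
Proof.
destruct n as [|n].
- exists (fun _ => RtoC 0). split; [apply polynomial_const|].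
  intros z. unfold polyval. rewrite sum_O. simpl. ring.
- exists (polyval (fun k => c (S k)) n). split; [apply polynomial_polyval|].
  apply polyval_head.
Qed.

(* The quotient [(P - c0) / (z (1 - conj c0 P))] is not a polynomial, but the
   truncated geometric expansion of [1 / (1 - conj c0 P)] makes it one up to a
   factor [1 - (conj c0 P) ^ (m+1)], to which the maximum modulus principle
   applies. *)
Lemma polynomial_schwarz_pick_approx (c : nat -> C) (n m : nat) (w : C) :
  (forall z, Cmod z = 1 -> Cmod (polyval c n z) <= 1) ->
  Cmod (c 0%nat) < 1 -> Cmod w <= 1 ->
  Cmod (polyval c n w - c 0%nat) * (1 - Cmod (c 0%nat) ^ S m) <=
  Cmod w * (1 + Cmod (c 0%nat) ^ S m) *
    Cmod (1 - Cconj (c 0%nat) * polyval c n w).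
Proof.
intros H Ha Hw. set (P := polyval c n) in *. set (a := Cmod (c 0%nat)) in *.
assert (Ha0 : 0 <= a) by apply Cmod_ge_0.
assert (Ham : 0 <= a ^ S m) by (apply pow_le, Ha0).
assert (HPle : forall z, Cmod z <= 1 -> Cmod (P z) <= 1).
{ intros z Hz. apply polynomial_max_modulus; try assumption; [|lra].
  apply polynomial_polyval. }
assert (Hpow : forall z, Cmod z <= 1 ->
  Cmod ((Cconj (c 0%nat) * P z) ^ S m) <= a ^ S m).
{ intros z Hz. rewrite Cmod_pow, Cmod_conj_mult. fold a.
  specialize (HPle z Hz). pose proof (Cmod_ge_0 (P z)).
  apply pow_incr. split; nra. }
destruct (polynomial_divide_X c n) as [q [Hq HPq]]. fold P in HPq.
set (G := fun z => sum_n (fun j => ((Cconj (c 0%nat) * P z) ^ j)%C) m : C).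
assert (HG : forall z, (G z * (1 - Cconj (c 0%nat) * P z))%C =
                       (1 - (Cconj (c 0%nat) * P z) ^ S m)%C).
{ intros z. rewrite <- sum_geomC. unfold G. ring. }
assert (HR : Cmod (q w * G w) <= 1 + a ^ S m).
{ apply (polynomial_max_modulus (fun z => (q z * G z)%C)); [|lra| |exact Hw].
  - apply polynomial_mult; [exact Hq|].
    apply (polynomial_sum_n (fun j z => ((Cconj (c 0%nat) * P z) ^ j)%C)).
    intros j. apply (polynomial_pow (fun z => (Cconj (c 0%nat) * P z)%C)).
    apply polynomial_scal, polynomial_polyval.
  - intros z Hz. assert (HPz := HPle z (Req_le _ _ Hz)).
    assert (Hd := schwarz_pick_denominator_pos (c 0%nat) (P z) Ha HPz).
    apply Rmult_le_reg_r with (Cmod (1 - Cconj (c 0%nat) * P z)); [exact Hd|].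
    rewrite <- Cmod_mult, <- Cmult_assoc, HG, Cmod_mult.
    assert (Hqz : Cmod (q z) <= Cmod (1 - Cconj (c 0%nat) * P z)).
    { replace (Cmod (q z)) with (Cmod (P z - c 0%nat)).
      - apply schwarz_pick_boundary; [fold a; lra|exact HPz].
      - rewrite HPq. replace (c 0%nat + z * q z - c 0%nat)%C with (z * q z)%C by ring.
        rewrite Cmod_mult, Hz. ring. }
    rewrite Rmult_comm. apply Rmult_le_compat; try apply Cmod_ge_0; [|exact Hqz].
    eapply Rle_trans; [apply Cmod_one_minus_le|].
    specialize (Hpow z (Req_le _ _ Hz)). lra. }
(* At [w] the factor [G w] is removed again: [G w] times the denominator is
   [1 - (conj c0 P(w)) ^ S m], which is nearly 1. *)
assert (Hlow : 1 - a ^ S m <= Cmod (1 - (Cconj (c 0%nat) * P w) ^ S m)).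
{ eapply Rle_trans; [|apply Cmod_one_minus_ge]. specialize (Hpow w Hw). lra. }
rewrite <- HG, Cmod_mult in Hlow.
replace (P w - c 0%nat)%C with (w * q w)%C by (rewrite HPq; ring).
rewrite Cmod_mult. rewrite Cmod_mult in HR.
pose proof (Cmod_ge_0 w). pose proof (Cmod_ge_0 (q w)).
pose proof (Cmod_ge_0 (1 - Cconj (c 0%nat) * P w)).
eapply Rle_trans.
{ apply Rmult_le_compat_l; [apply Rmult_le_pos; assumption|exact Hlow]. }
replace (Cmod w * Cmod (q w) * (Cmod (G w) * Cmod (1 - Cconj (c 0%nat) * P w)))
  with (Cmod w * (Cmod (q w) * Cmod (G w)) * Cmod (1 - Cconj (c 0%nat) * P w)) by ring.
apply Rmult_le_compat_r; [assumption|]. apply Rmult_le_compat_l; assumption.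
Qed.

(** The limit of the approximate inequality as [m] grows, since [Cmod (c 0) ^ S m] tends to 0. *)
Lemma polynomial_schwarz_pick (c : nat -> C) (n : nat) (w : C) :
  (forall z, Cmod z = 1 -> Cmod (polyval c n z) <= 1) ->
  Cmod (c 0%nat) < 1 -> Cmod w <= 1 ->
  Cmod (polyval c n w - c 0%nat) <=
  Cmod w * Cmod (1 - Cconj (c 0%nat) * polyval c n w).
Proof.
intros H Ha Hw.
pose proof (fun m => polynomial_schwarz_pick_approx c n m w H Ha Hw) as Happ.
set (D := Cmod (polyval c n w - c 0%nat)) in *.
set (E := Cmod (1 - Cconj (c 0%nat) * polyval c n w)) in *.
assert (HD : 0 <= D) by apply Cmod_ge_0.
assert (HE : 0 <= Cmod w * E) by (apply Rmult_le_pos; apply Cmod_ge_0).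
destruct (Rle_or_lt D (Cmod w * E)) as [?|Hlt]; [assumption|exfalso].
(* With [e] the power of [Cmod (c 0)], the approximate inequality
   [D * (1 - e) <= Cmod w * E * (1 + e)] fails as soon as [e] is below this quotient. *)
destruct (powers_small (Cmod (c 0%nat)) ((D - Cmod w * E) / (D + Cmod w * E)))
  as [m Hm].
- split; [apply Cmod_ge_0|exact Ha].
- apply Rdiv_lt_0_compat; lra.
- specialize (Happ m). set (e := Cmod (c 0%nat) ^ S m) in *.
  apply (Rmult_lt_compat_r (D + Cmod w * E)) in Hm; [|lra].
  unfold Rdiv in Hm. rewrite Rmult_assoc, Rinv_l in Hm by lra. nra.
Qed.

(** * Growth and coefficient-sum bounds for polynomials *)

Lemma polynomial_growth (c : nat -> C) (n : nat) (w : C) :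
  (forall z, Cmod z = 1 -> Cmod (polyval c n z) <= 1) ->
  Cmod (c 0%nat) < 1 -> Cmod w <= 1 ->
  Cmod (polyval c n w) <=
  (Cmod (c 0%nat) + Cmod w) / (1 + Cmod (c 0%nat) * Cmod w).
Proof.
intros H Ha Hw.
assert (HSP := polynomial_schwarz_pick c n w H Ha Hw).
assert (HP : Cmod (polyval c n w) <= 1).
{ apply polynomial_max_modulus; try assumption; [|lra]. apply polynomial_polyval. }
pose proof (schwarz_pick_identity (c 0%nat) (polyval c n w)) as Hid.
pose proof (Cmod_one_minus_ge (Cconj (c 0%nat) * polyval c n w)) as Hge.
rewrite Cmod_conj_mult in Hge.
set (D := Cmod (polyval c n w - c 0%nat)) in *.
set (E := Cmod (1 - Cconj (c 0%nat) * polyval c n w)) in *.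
set (x := Cmod (polyval c n w)) in *. set (a := Cmod (c 0%nat)) in *.
set (r := Cmod w) in *.
assert (0 <= a /\ 0 <= x /\ 0 <= r /\ 0 <= D /\ 0 <= E) as [Ha0 [Hx0 [Hr0 [HD HE]]]]
  by (repeat split; apply Cmod_ge_0).
apply Rmult_le_reg_r with (1 + a * r); [nra|].
unfold Rdiv. rewrite Rmult_assoc, Rinv_l by nra. rewrite Rmult_1_r.
assert (Hax : 0 <= 1 - a * x) by nra.
assert (HD2 : D ^ 2 <= r ^ 2 * E ^ 2).
{ rewrite <- Rpow_mult_distr. apply pow_incr. lra. }
assert (HE2 : (1 - a * x) ^ 2 <= E ^ 2) by (apply pow_incr; lra).
assert (Hr2 : 0 <= 1 - r ^ 2) by nra.
(* Inserting [D <= r * E] into the identity [E^2 = D^2 + (1 - a^2) * (1 - x^2)] bounds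
   [E^2 * (1 - r^2)]. With [E >= 1 - a * x] this is the real form of the Schwarz-Pick inequality. *)
assert (Hsq : (x - a) ^ 2 <= (r * (1 - a * x)) ^ 2).
{ assert (E ^ 2 * (1 - r ^ 2) <= (1 - a ^ 2) * (1 - x ^ 2)) by lra.
  assert ((1 - a * x) ^ 2 * (1 - r ^ 2) <= E ^ 2 * (1 - r ^ 2))
    by (apply Rmult_le_compat_r; assumption).
  replace ((x - a) ^ 2) with ((1 - a * x) ^ 2 - (1 - a ^ 2) * (1 - x ^ 2)) by ring.
  rewrite Rpow_mult_distr. lra. }
assert (x - a <= r * (1 - a * x)).
{ rewrite <- !Rsqr_pow2 in Hsq. apply Rsqr_incr_0_var; [exact Hsq|].
  apply Rmult_le_pos; assumption. }
nra.
Qed.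

(* Parseval applied to the Schwarz-Pick inequality on the circle of radius [t]:
   [1 - conj c0 P] splits orthogonally as [(1 - a^2) - conj c0 (P - c0)]. *)
Lemma polynomial_square_sum (c : nat -> C) (n : nat) (t : R) :
  (forall z, Cmod z = 1 -> Cmod (polyval c (S n) z) <= 1) ->
  Cmod (c 0%nat) < 1 -> 0 <= t <= 1 ->
  sum_n (fun k => (Cmod (c (S k)) * t ^ S k) ^ 2) n *
    (1 - Cmod (c 0%nat) ^ 2 * t ^ 2) <=
  t ^ 2 * (1 - Cmod (c 0%nat) ^ 2) ^ 2.
Proof.
intros H Ha Ht. set (a := Cmod (c 0%nat)) in *.
(* [d] and [e] are the coefficients of [P(t z) - c0] and [1 - conj c0 P(t z)]. *)
set (d := fun k => match k with O => RtoC 0 | S _ => (c k * RtoC t ^ k)%C end).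
set (e := fun k => match k with
  | O => RtoC (1 - a ^ 2) | S _ => (- Cconj (c 0%nat) * (c k * RtoC t ^ k))%C end).
set (T := sum_n (fun k => (Cmod (c (S k)) * t ^ S k) ^ 2) n : R).
assert (Htmod : Cmod t = t) by (rewrite Cmod_R, Rabs_pos_eq; lra).
assert (Hterm : forall k, Cmod (c k * RtoC t ^ k) = Cmod (c k) * t ^ k).
{ intros k. rewrite Cmod_mult, Cmod_pow, Htmod. reflexivity. }
assert (Hd : forall z, polyval d (S n) z = (polyval c (S n) (t * z) - c 0%nat)%C).
{ intros z. rewrite !polyval_head. unfold d at 1.
  replace (polyval (fun k => d (S k)) n z)
    with (t * polyval (fun k => c (S k)) n (t * z))%C; [ring|].
  unfold polyval. rewrite <- sumC_mult_l. apply sumC_ext. intros k.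
  unfold d. rewrite Cpow_mult_l, Cpow_S. ring. }
assert (He : forall z, polyval e (S n) z =
  (1 - Cconj (c 0%nat) * polyval c (S n) (t * z))%C).
{ intros z.
  replace (polyval e (S n) z) with
    (RtoC (1 - a ^ 2) - Cconj (c 0%nat) * polyval d (S n) z)%C.
  - rewrite Hd, RtoC_minus, RtoC_pow.
    unfold a. rewrite <- RtoC_pow, Cmod2_conj. ring.
  - rewrite !polyval_head. unfold d at 1, e at 1.
    replace (polyval (fun k => e (S k)) n z)
      with (- Cconj (c 0%nat) * polyval (fun k => d (S k)) n z)%C; [ring|].
    unfold polyval. rewrite <- sumC_mult_l. apply sumC_ext. intros k.
    unfold d, e. ring. }
assert (Hp := parseval_le d e (S n) t).
rewrite !sum_n_head in Hp.
change (d 0%nat) with (RtoC 0) in Hp.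
change (e 0%nat) with (RtoC (1 - a ^ 2)) in Hp.
rewrite Cmod_0, Cmod_R, pow2_abs in Hp.
rewrite (sumR_ext (fun k => Cmod (d (S k)) ^ 2)
  (fun k => (Cmod (c (S k)) * t ^ S k) ^ 2)) in Hp
  by (intros k; unfold d; rewrite Hterm; reflexivity).
rewrite (sumR_ext (fun k => Cmod (e (S k)) ^ 2)
  (fun k => a ^ 2 * (Cmod (c (S k)) * t ^ S k) ^ 2)) in Hp
  by (intros k; unfold e; rewrite Cmod_mult, Hterm, Cmod_opp, Cmod_conj;
      fold a; ring).
rewrite sum_n_scal in Hp. fold T in Hp.
(* The unknown sum [T] occurs on both sides; collecting it yields the factor [1 - a^2 * t^2]. *)
enough (0 ^ 2 + T <= t ^ 2 * ((1 - a ^ 2) ^ 2 + a ^ 2 * T)) by nra.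
apply Hp. intros z Hz. rewrite Hd, He.
assert (Htz : Cmod (t * z) = t) by (rewrite Cmod_mult, Htmod, Hz; ring).
rewrite <- Htz at 2. apply polynomial_schwarz_pick; try assumption. lra.
Qed.

(* Cauchy-Schwarz with the weights [t ^ k] and [(a t) ^ k], where [r = a t^2]. *)
Lemma polynomial_coefficient_sum (c : nat -> C) (n : nat) (r : R) :
  (forall z, Cmod z = 1 -> Cmod (polyval c (S n) z) <= 1) ->
  Cmod (c 0%nat) < 1 -> 0 <= r < Cmod (c 0%nat) ->
  sum_n (fun k => Cmod (c (S k)) * r ^ S k) n <=
  (1 - Cmod (c 0%nat) ^ 2) * r / (1 - Cmod (c 0%nat) * r).
Proof.
intros H Ha Hr. set (a := Cmod (c 0%nat)) in *.
set (t := sqrt (r / a)).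
assert (Hra : 0 <= r / a) by (apply Rdiv_le_0_compat; lra).
assert (Ht0 : 0 <= t) by apply sqrt_pos.
assert (Ht2 : a * t ^ 2 = r).
{ unfold t. rewrite pow2_sqrt by exact Hra. field. lra. }
assert (Ht : 0 <= t <= 1) by (split; [exact Ht0|]; apply Rnot_lt_le; intros Hgt;
  assert (a * 1 < a * t ^ 2) by (apply Rmult_lt_compat_l; nra); lra).
pose proof (polynomial_square_sum c n t H Ha Ht) as HT. fold a in HT.
set (T := sum_n (fun k => (Cmod (c (S k)) * t ^ S k) ^ 2) n : R) in *.
set (U := sum_n (fun k => ((a * t) ^ S k) ^ 2) n : R).
assert (Hq : 0 <= a * r < 1) by nra.
replace (a ^ 2 * t ^ 2) with (a * r) in HT by (rewrite <- Ht2; ring).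
assert (HU : U * (1 - a * r) <= a * r).
{ unfold U. rewrite (sumR_ext _ (fun k => (a * r) * (a * r) ^ k)).
  - rewrite sum_n_scal. pose proof (sum_geomR_le (a * r) n Hq) as Hg.
    apply (Rmult_le_compat_r (1 - a * r)) in Hg; [|lra].
    rewrite Rinv_l in Hg by lra. rewrite Rmult_assoc.
    apply Rle_trans with (a * r * 1); [|lra].
    apply Rmult_le_compat_l; [lra|exact Hg].
  - intros k. rewrite <- pow_mult, Nat.mul_comm, pow_mult.
    replace ((a * t) ^ 2) with (a * r) by (rewrite <- Ht2; ring). reflexivity. }
(* Cauchy-Schwarz is used as [u * v <= l / 2 * u^2 + v^2 / (2 * l)]. This [l] makes the bounds for
   the two halves equal, so nothing is lost. *)
set (l := a / (1 - a ^ 2)).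
assert (Ha2 : 0 < 1 - a ^ 2) by nra.
assert (Hl : 0 < l) by (apply Rdiv_lt_0_compat; lra).
assert (Hsum : sum_n (fun k => Cmod (c (S k)) * r ^ S k) n <= l / 2 * T + / (2 * l) * U).
{ unfold T, U. rewrite <- !sum_n_scal, <- sum_n_add.
  apply sum_n_le_loc. intros k _.
  set (u := Cmod (c (S k)) * t ^ S k). set (v := (a * t) ^ S k).
  replace (Cmod (c (S k)) * r ^ S k) with (u * v).
  - apply Rmult_le_reg_l with (2 * l); [lra|].
    replace (2 * l * (l / 2 * u ^ 2 + / (2 * l) * v ^ 2))
      with (l ^ 2 * u ^ 2 + v ^ 2) by (field; lra).
    pose proof (pow2_ge_0 (l * u - v)). nra.
  - unfold u, v. rewrite <- Ht2. rewrite !Rpow_mult_distr, <- pow_mult.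
    replace (2 * S k)%nat with (S k + S k)%nat by lia. rewrite pow_add. ring. }
eapply Rle_trans; [exact Hsum|].
apply Rmult_le_reg_r with (1 - a * r); [lra|].
replace ((1 - a ^ 2) * r / (1 - a * r) * (1 - a * r)) with
  (l / 2 * (t ^ 2 * (1 - a ^ 2) ^ 2) + / (2 * l) * (a * r)).
- assert (l / 2 * (T * (1 - a * r)) <= l / 2 * (t ^ 2 * (1 - a ^ 2) ^ 2))
    by (apply Rmult_le_compat_l; lra).
  assert (/ (2 * l) * (U * (1 - a * r)) <= / (2 * l) * (a * r)).
  { apply Rmult_le_compat_l; [|exact HU]. left. apply Rinv_0_lt_compat. lra. }
  lra.
- unfold l. rewrite <- Ht2. field. split; [|split]; nra.
Qed.

(** * Passage from polynomials to analytic functions *)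

Lemma is_pseries_polyval (c : nat -> C) (z l : C) :
  is_pseries (K := C_AbsRing) (V := C_NormedModule) c z l <->
  filterlim (fun n => polyval c n z) eventually (locally (T := C_NormedModule) l).
Proof.
assert (E : forall n, polyval c n z =
  sum_n (fun k => scal (V := C_NormedModule) (pow_n (K := C_AbsRing) z k) (c k)) n).
{ intros n. apply sumC_ext. intros k. rewrite Cmult_comm.
  reflexivity. }
split; apply filterlim_ext; intros n; rewrite E; reflexivity.
Qed.

Lemma analytic_polyval_lim (f : C -> C) (c : nat -> C) (z : C) :
  analytic_in_disk f c -> Cmod z < 1 ->
  is_lim_seq (fun n => Cmod (polyval c n z)) (Cmod (f z)).
Proof.
intros Hf Hz.
refine (filterlim_comp _ _ _ (fun n => polyval c n z) (@norm C_AbsRing C_NormedModule)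
  _ (locally (T := C_NormedModule) (f z)) _ _
  (filterlim_norm (K := C_AbsRing) (V := C_NormedModule) (f z))).
apply is_pseries_polyval, Hf, Hz.
Qed.

Lemma analytic_value_0 (f : C -> C) (c : nat -> C) :
  analytic_in_disk f c -> Cmod (f 0) = Cmod (c 0%nat).
Proof.
intros Hf. assert (H := analytic_polyval_lim f c 0 Hf).
rewrite Cmod_0 in H. specialize (H Rlt_0_1).
apply is_lim_seq_unique in H.
rewrite (Lim_seq_ext _ (fun _ => Cmod (c 0%nat))), Lim_seq_const in H
  by (intros n; rewrite polyval_0; reflexivity).
injection H as H. symmetry. exact H.
Qed.

(** At the intermediate radius [s] the partial sums converge, so the terms are bounded; at radius
    [r] the terms are then dominated by a geometric series of ratio [r / s < 1]. *)
Lemma analytic_abs_summable (f : C -> C) (c : nat -> C) (r : R) :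
  analytic_in_disk f c -> 0 <= r < 1 ->
  ex_series (fun k => Cmod (c k) * r ^ k).
Proof.
intros Hf Hr. set (s := (1 + r) / 2).
assert (Hs : Cmod s = s) by (rewrite Cmod_R, Rabs_pos_eq; unfold s; lra).
destruct (filterlim_bounded (K := C_AbsRing) (V := C_NormedModule)
  (fun n => polyval c n s)) as [M HM].
{ exists (f s). apply is_pseries_polyval, Hf. rewrite Hs; unfold s; lra. }
assert (HM' : forall n, Cmod (polyval c n s) <= M) by exact HM.
assert (Hterm : forall k, Cmod (c k) * s ^ k <= 2 * M).
{ intros k. rewrite <- Hs, <- Cmod_pow, <- Cmod_mult.
  pose proof (Cmod_ge_0 (polyval c 0 s)). destruct k as [|k].
  - replace (c 0%nat * s ^ 0)%C with (polyval c 0 s).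
    + specialize (HM' 0%nat). lra.
    + unfold polyval. rewrite sum_O. reflexivity.
  - replace (c (S k) * s ^ S k)%C with (polyval c (S k) s - polyval c k s)%C
      by (rewrite polyval_S; ring).
    pose proof (Cmod_triangle (polyval c (S k) s) (- polyval c k s)) as Ht.
    rewrite Cmod_opp in Ht. pose proof (HM' k). pose proof (HM' (S k)).
    unfold Cminus. lra. }
apply (ex_series_le (K := R_AbsRing) (V := R_CompleteNormedModule) _
  (fun k => 2 * M * (r / s) ^ k)).
- intros k. change norm with Rabs.
  assert (Hsk : 0 < s ^ k) by (apply pow_lt; unfold s; lra).
  assert (Hrk : 0 <= r ^ k) by (apply pow_le; lra).
  rewrite Rabs_pos_eq by (apply Rmult_le_pos; [apply Cmod_ge_0|exact Hrk]).
  unfold Rdiv. rewrite Rpow_mult_distr, pow_inv.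
  replace (Cmod (c k) * r ^ k) with (Cmod (c k) * s ^ k * (r ^ k * / s ^ k))
    by (field; lra).
  apply Rmult_le_compat_r; [|apply Hterm].
  apply Rmult_le_pos; [exact Hrk|]. left. apply Rinv_0_lt_compat, Hsk.
- apply (ex_series_scal_l (2 * M) (fun k => (r / s) ^ k)), ex_series_geom.
  rewrite Rabs_pos_eq.
  + apply Rmult_lt_reg_r with s; [unfold s; lra|].
    unfold Rdiv. rewrite Rmult_assoc, Rinv_l; unfold s; lra.
  + apply Rdiv_le_0_compat; unfold s; lra.
Qed.

(** The terms between the two truncations are dominated by those at radius [s], which makes the
    error independent of [z]. *)
Lemma polyval_truncation_le (c : nat -> C) (z : C) (s : R) (n j : nat) :
  Cmod z <= s ->
  Cmod (polyval c n z) <= Cmod (polyval c (n + j) z) +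
    (sum_n (fun k => Cmod (c k) * s ^ k) (n + j) -
     sum_n (fun k => Cmod (c k) * s ^ k) n).
Proof.
intros Hz. induction j as [|j IH].
- rewrite Nat.add_0_r. lra.
- rewrite Nat.add_succ_r, sumR_S, polyval_S.
  set (m := (n + j)%nat) in *.
  pose proof (Cmod_sub_ge (polyval c m z) (- (c (S m) * z ^ S m))) as Ht.
  rewrite Cmod_opp, Cmod_mult, Cmod_pow in Ht.
  replace (polyval c m z - - (c (S m) * z ^ S m))%C
    with (polyval c m z + c (S m) * z ^ S m)%C in Ht by ring.
  assert (Cmod (c (S m)) * Cmod z ^ S m <= Cmod (c (S m)) * s ^ S m).
  { apply Rmult_le_compat_l; [apply Cmod_ge_0|].
    apply pow_incr. split; [apply Cmod_ge_0|exact Hz]. }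
  lra.
Qed.

Lemma analytic_truncation_uniform (f : C -> C) (c : nat -> C) (s d : R) :
  analytic_in_disk f c -> 0 <= s < 1 -> 0 < d ->
  exists N, forall n z, (N <= n)%nat -> Cmod z <= s ->
    Cmod (polyval c n z) <= Cmod (f z) + d.
Proof.
intros Hf Hs Hd. set (u := fun k => Cmod (c k) * s ^ k).
assert (Hu0 : forall k, 0 <= u k).
{ intros k. apply Rmult_le_pos; [apply Cmod_ge_0|apply pow_le, Hs]. }
destruct (analytic_abs_summable f c s Hf Hs) as [L HL].
assert (HL' : is_lim_seq (sum_n u) L) by exact HL.
destruct (proj2 (is_lim_seq_spec _ _) HL' (mkposreal d Hd)) as [N HN].
exists N. intros n z Hn Hz. specialize (HN n Hn). simpl in HN.
apply Rabs_def2 in HN.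
(* With [n] fixed, [j] tends to infinity: the longer truncation tends to [f z], while the error
   stays below [d]. *)
apply (is_lim_seq_le (fun _ => Cmod (polyval c n z))
  (fun j => Cmod (polyval c (n + j) z) + d) (Cmod (polyval c n z)) (Cmod (f z) + d)).
- intros j. eapply Rle_trans; [apply (polyval_truncation_le c z s n j Hz)|].
  fold u. apply Rplus_le_compat_l.
  assert (sum_n u (n + j) <= L).
  { apply (is_lim_seq_incr_compare (sum_n u)); [exact HL'|].
    intros k. rewrite sumR_S. specialize (Hu0 (S k)). lra. }
  lra.
- apply is_lim_seq_const.
- apply is_lim_seq_plus'; [|apply is_lim_seq_const].
  apply (is_lim_seq_ext (fun j => Cmod (polyval c (j + n) z))).
  { intros j. rewrite Nat.add_comm. reflexivity. }
  apply (is_lim_seq_incr_n (fun j => Cmod (polyval c j z))).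
  apply analytic_polyval_lim; [exact Hf|lra].
Qed.

(* [e > 1] is the margin by which the truncations of [f], dilated by [1 / e],
   are scaled down in order to be bounded by [1] on the unit circle. *)
Lemma analytic_bohr_sum_approx (f : C -> C) (c : nat -> C) (z : C) (e : R) :
  let a := Cmod (c 0%nat) in let r := Cmod z in
  analytic_in_disk f c -> maps_disk_into_disk f -> a < 1 ->
  1 < e -> r * e ^ 2 < a ->
  Cmod (f z) + Series (fun k => Cmod (c (S k)) * r ^ S k) <=
  (a + r * e ^ 2) / (1 + a * r) + (e ^ 2 - a ^ 2) * r / (1 - a * r).
Proof.
intros a r Hf Hmap Ha He Hre.
assert (Hr0 : 0 <= r) by apply Cmod_ge_0.
assert (Ha0 : 0 <= a) by apply Cmod_ge_0.
assert (He2 : 1 < e ^ 2) by nra.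
assert (Hr : 0 <= r < 1) by nra.
set (s := / e).
assert (Hs : 0 < s < 1).
{ unfold s. split; [apply Rinv_0_lt_compat; lra|].
  rewrite <- Rinv_1. apply Rinv_lt_contravar; lra. }
assert (Hse : s * e = 1) by (unfold s; field; lra).
assert (HsC : (RtoC s * RtoC e)%C = 1) by (rewrite <- RtoC_mult, Hse; reflexivity).
assert (HsM : Cmod s = s) by (rewrite Cmod_R, Rabs_pos_eq; lra).
assert (HeM : Cmod e = e) by (rewrite Cmod_R, Rabs_pos_eq; lra).
(* On the circle of radius [s = / e] the truncations are at most [1 + (e - 1) = e], so multiplying
   them by [s] gives polynomials bounded by 1. *)
destruct (analytic_truncation_uniform f c s (e - 1) Hf) as [N HN]; [lra|lra|].
set (p := fun k => (c k * RtoC s ^ S k)%C).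
assert (Hp : forall n w, polyval p n w = (s * polyval c n (s * w))%C).
{ intros n w. unfold polyval. rewrite <- sumC_mult_l. apply sumC_ext. intros k.
  unfold p. rewrite Cpow_S, Cpow_mult_l. ring. }
assert (Hp1 : forall n, (N <= n)%nat -> forall w, Cmod w = 1 ->
  Cmod (polyval p n w) <= 1).
{ intros n Hn w Hw. rewrite Hp, Cmod_mult, HsM, <- Hse.
  assert (Hsw : Cmod (s * w) = s) by (rewrite Cmod_mult, HsM, Hw; ring).
  apply Rmult_le_compat_l; [lra|].
  specialize (HN n (s * w)%C Hn (Req_le _ _ Hsw)).
  specialize (Hmap (s * w)%C). rewrite Hsw in Hmap. specialize (Hmap (proj2 Hs)). lra. }
assert (Hp0 : Cmod (p 0%nat) = s * a).
{ unfold p. rewrite Cmod_mult, Cmod_pow, HsM. unfold a. ring. }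
assert (Hpk : forall k, Cmod (p (S k)) * (e * r) ^ S k =
  s * (Cmod (c (S k)) * r ^ S k)).
{ intros k. unfold p. rewrite Cmod_mult, Cmod_pow, HsM.
  rewrite (Rpow_mult_distr e).
  replace (s ^ S (S k)) with (s * s ^ S k) by reflexivity.
  replace (Cmod (c (S k)) * (s * s ^ S k) * (e ^ S k * r ^ S k))
    with (s * (Cmod (c (S k)) * (s ^ S k * e ^ S k) * r ^ S k)) by ring.
  rewrite <- Rpow_mult_distr, Hse, pow1. ring. }
assert (Her : 0 <= e * r < s * a).
{ split; [nra|]. apply Rmult_lt_reg_l with e; [lra|].
  replace (e * (s * a)) with (s * e * a) by ring. rewrite Hse. nra. }
assert (Hsa : s * a < 1) by nra.
assert (Hew : Cmod (e * z) = e * r) by (rewrite Cmod_mult, HeM; reflexivity).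
assert (Hfin : forall n, (N <= n)%nat ->
  Cmod (polyval c (S n) z) + sum_n (fun k => Cmod (c (S k)) * r ^ S k) n <=
  (a + r * e ^ 2) / (1 + a * r) + (e ^ 2 - a ^ 2) * r / (1 - a * r)).
{ intros n Hn.
  (* Dilation is undone by evaluating at [e * z], where [p] gives [s] times the truncation of [f].
     The product of constant term and radius stays [s * a * (e * r) = a * r], so the denominators
     keep their form. *)
  assert (HG := polynomial_growth p (S n) (e * z) (Hp1 (S n) ltac:(lia))).
  assert (HS := polynomial_coefficient_sum p n (e * r) (Hp1 (S n) ltac:(lia))).
  rewrite Hp0 in HG, HS. rewrite Hew in HG.
  specialize (HG Hsa ltac:(lra)). specialize (HS Hsa Her).
  rewrite Hp, Cmult_assoc, HsC, Cmult_1_l, Cmod_mult, HsM in HG.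
  rewrite (sumR_ext _ (fun k => s * (Cmod (c (S k)) * r ^ S k)) n Hpk), sum_n_scal in HS.
  apply Rmult_le_reg_l with s; [lra|].
  rewrite Rmult_plus_distr_l. eapply Rle_trans; [apply Rplus_le_compat; eassumption|].
  apply Req_le. replace (s * a * (e * r)) with (a * r) by
    (transitivity (s * e * (a * r)); [rewrite Hse|]; ring).
  unfold s. field. repeat split; nra. }
assert (Hex : ex_series (fun k => Cmod (c (S k)) * r ^ S k)).
{ apply (ex_series_incr_1 (fun k => Cmod (c k) * r ^ k)).
  apply (analytic_abs_summable f c r Hf Hr). }
apply (is_lim_seq_le_loc
  (fun n => Cmod (polyval c (S n) z) + sum_n (fun k => Cmod (c (S k)) * r ^ S k) n)
  (fun _ => (a + r * e ^ 2) / (1 + a * r) + (e ^ 2 - a ^ 2) * r / (1 - a * r))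
  (Cmod (f z) + Series (fun k => Cmod (c (S k)) * r ^ S k))
  ((a + r * e ^ 2) / (1 + a * r) + (e ^ 2 - a ^ 2) * r / (1 - a * r))).
- exists N. exact Hfin.
- apply is_lim_seq_plus'.
  + apply (is_lim_seq_incr_1 (fun n => Cmod (polyval c n z))).
    apply analytic_polyval_lim; [exact Hf|apply Hr].
  + exact (Series_correct _ Hex).
- apply is_lim_seq_const.
Qed.

(** The limit [e -> 1]: with [e^2 = 1 + y] the approximate bound is [B + y * K], too small for a
    supposed excess [X - B > 0] once [y] is small. *)
Lemma analytic_bohr_sum (f : C -> C) (c : nat -> C) (z : C) :
  let a := Cmod (c 0%nat) in let r := Cmod z in
  analytic_in_disk f c -> maps_disk_into_disk f -> a < 1 -> r < a ->
  Cmod (f z) + Series (fun k => Cmod (c (S k)) * r ^ S k) <=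
  (a + r) / (1 + a * r) + (1 - a ^ 2) * r / (1 - a * r).
Proof.
intros a r Hf Hmap Ha Hra.
assert (Hr0 : 0 <= r) by apply Cmod_ge_0.
set (X := Cmod (f z) + _). set (B := _ + _).
apply Rnot_lt_le. intros HBX.
set (K := r / (1 + a * r) + r / (1 - a * r)).
assert (HK : 0 <= K).
{ apply Rplus_le_le_0_compat; apply Rdiv_le_0_compat; nra. }
(* The first entry keeps [r * (1 + y) < a], the second gives [y * K < X - B]; [K + 1] avoids a zero
   denominator. *)
set (y := Rmin ((a - r) / 2) ((X - B) / (2 * (K + 1)))).
assert (Hy : 0 < y) by (apply Rmin_glb_lt; apply Rdiv_lt_0_compat; lra).
assert (Hy1 : y <= (a - r) / 2) by apply Rmin_l.
assert (Hy2 : y * (2 * (K + 1)) <= X - B).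
{ apply Rle_trans with ((X - B) / (2 * (K + 1)) * (2 * (K + 1))).
  - apply Rmult_le_compat_r; [lra|apply Rmin_r].
  - apply Req_le. field. lra. }
assert (He2 : sqrt (1 + y) ^ 2 = 1 + y) by (apply pow2_sqrt; lra).
assert (He : 1 < sqrt (1 + y)) by (rewrite <- sqrt_1 at 1; apply sqrt_lt_1_alt; lra).
pose proof (analytic_bohr_sum_approx f c z (sqrt (1 + y)) Hf Hmap Ha He) as H.
fold a r in H. rewrite He2 in H. specialize (H ltac:(nra)). fold X in H.
replace ((a + r * (1 + y)) / (1 + a * r) + (1 + y - a ^ 2) * r / (1 - a * r))
  with (B + y * K) in H; [nra|].
unfold B, K. field. split; nra.
Qed.

(** * The quadratic equation for the radius *)

(** Cleared of its positive denominators, one minus the left side has the positive factor [1 - a],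
    and the quadratic condition remains. The equivalence serves both the inequality and its
    sharpness. *)
Lemma bohr_sum_bound_le_1 (a r : R) :
  0 <= a < 1 -> 0 <= r <= 1 ->
  (a + r) / (1 + a * r) + (1 - a ^ 2) * r / (1 - a * r) <= 1 <->
  a ^ 2 * r ^ 2 + 2 * (1 + a) * r <= 1.
Proof.
intros Ha Hr.
assert (Har : 0 <= a * r < 1) by nra.
assert (HD : 0 < (1 + a * r) * (1 - a * r)) by nra.
assert (E : (1 - ((a + r) / (1 + a * r) + (1 - a ^ 2) * r / (1 - a * r))) *
  ((1 + a * r) * (1 - a * r)) =
  (1 - a) * (1 - (a ^ 2 * r ^ 2 + 2 * (1 + a) * r))) by (field; nra).
split; intros H; apply Rnot_lt_le; intros Hlt; nra.
Qed.

(** A rational bound on the threshold, which reduces [bohr_radius_lt] to polynomial arithmetic. *)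
Lemma sqrt3_lower : 2 / 5 < 2 * sqrt 3 - 3.
Proof.
assert (17 / 10 < sqrt 3); [|lra].
rewrite <- (sqrt_pow2 (17 / 10)) by lra. apply sqrt_lt_1_alt. lra.
Qed.

Lemma bohr_radius_rationalized (a : R) :
  0 < a -> bohr_radius a = 1 / (sqrt ((1 + a) ^ 2 + a ^ 2) + 1 + a).
Proof.
intros Ha. unfold bohr_radius.
assert (HS2 : sqrt ((1 + a) ^ 2 + a ^ 2) ^ 2 = (1 + a) ^ 2 + a ^ 2)
  by (apply pow2_sqrt; nra).
pose proof (sqrt_pos ((1 + a) ^ 2 + a ^ 2)) as HS0.
set (S := sqrt _) in *.
apply Rmult_eq_reg_r with (a ^ 2 * (S + 1 + a)); [|nra].
field_simplify; nra.
Qed.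

Lemma bohr_radius_pos (a : R) : 0 < a -> 0 < bohr_radius a.
Proof.
intros Ha. rewrite bohr_radius_rationalized by exact Ha.
pose proof (sqrt_pos ((1 + a) ^ 2 + a ^ 2)). apply Rdiv_lt_0_compat; lra.
Qed.

Lemma bohr_radius_root (a : R) :
  0 < a -> a ^ 2 * bohr_radius a ^ 2 + 2 * (1 + a) * bohr_radius a = 1.
Proof.
intros Ha. unfold bohr_radius.
assert (HS2 : sqrt ((1 + a) ^ 2 + a ^ 2) ^ 2 = (1 + a) ^ 2 + a ^ 2)
  by (apply pow2_sqrt; nra).
set (S := sqrt _) in *.
replace (a ^ 2 * ((S - (1 + a)) / a ^ 2) ^ 2 + 2 * (1 + a) * ((S - (1 + a)) / a ^ 2))
  with ((S ^ 2 - (1 + a) ^ 2) / a ^ 2) by (field; lra).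
rewrite HS2. field. lra.
Qed.

(** Brings the radii in question into the range [r < a] of the coefficient-sum bound. The quadratic
    increases in [r >= 0], and at [r = a] it is [a^4 + 2 * (1 + a) * a], which exceeds 1 already for
    [a = 2 / 5]. *)
Lemma bohr_radius_lt (a : R) : 2 / 5 <= a -> bohr_radius a < a.
Proof.
intros Ha. pose proof (bohr_radius_root a ltac:(lra)) as H.
apply Rnot_le_lt. intros Hle.
assert (2 * (1 + a) * a <= 2 * (1 + a) * bohr_radius a)
  by (apply Rmult_le_compat_l; lra).
assert (a ^ 2 * a ^ 2 <= a ^ 2 * bohr_radius a ^ 2).
{ apply Rmult_le_compat_l; [nra|]. apply pow_incr. lra. }
nra.
Qed.

Lemma bohr_rogosinski_upto_radius (f : C -> C) (c : nat -> C) :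
  analytic_in_disk f c -> maps_disk_into_disk f ->
  2 * sqrt 3 - 3 <= Cmod (c 0%nat) ->
  bohr_rogosinski_upto f c (bohr_radius (Cmod (c 0%nat))).
Proof.
intros Hf Hmap Hc z Hz Hzr. pose proof sqrt3_lower as H3.
assert (Ha : Cmod (c 0%nat) < 1).
{ rewrite <- (analytic_value_0 f c Hf). apply Hmap. rewrite Cmod_0. lra. }
pose proof (bohr_radius_lt (Cmod (c 0%nat)) ltac:(lra)) as Hlt.
pose proof (bohr_radius_root (Cmod (c 0%nat)) ltac:(lra)) as Hroot.
pose proof (Cmod_ge_0 z) as Hz0.
split.
- apply (ex_series_incr_1 (fun k => Cmod (c k) * Cmod z ^ k)).
  apply (analytic_abs_summable f c (Cmod z) Hf). lra.
- eapply Rle_trans; [apply (analytic_bohr_sum f c z Hf Hmap Ha); lra|].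
  apply bohr_sum_bound_le_1; [lra|lra|].
  eapply Rle_trans; [|apply Req_le, Hroot].
  apply Rplus_le_compat; apply Rmult_le_compat_l; nra.
Qed.

(** * The extremal function and sharpness *)

Definition disk_automorphism (a : R) (z : C) : C := ((a - z) / (1 - a * z))%C.

(** Geometric expansion of [a - (1 - a^2) * z / (1 - a * z)]. *)
Definition disk_automorphism_coeff (a : R) (k : nat) : C :=
  match k with O => RtoC a | S k => RtoC (- ((1 - a ^ 2) * a ^ k)) end.

Lemma disk_denominator_neq_0 (a : R) (z : C) :
  0 <= a < 1 -> Cmod z < 1 -> (1 - a * z)%C <> 0.
Proof.
intros Ha Hz E. pose proof (Cmod_one_minus_ge (a * z)) as H.
rewrite E, Cmod_0, Cmod_mult, Cmod_R, Rabs_pos_eq in H by lra.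
pose proof (Cmod_ge_0 z). nra.
Qed.

Lemma disk_automorphism_maps_disk (a : R) :
  0 <= a < 1 -> maps_disk_into_disk (disk_automorphism a).
Proof.
intros Ha z Hz. pose proof (disk_denominator_neq_0 a z Ha Hz) as Hne.
unfold disk_automorphism. rewrite Cmod_div by exact Hne.
apply Cmod_gt_0 in Hne.
apply Rmult_lt_reg_r with (Cmod (1 - a * z)); [exact Hne|].
unfold Rdiv. rewrite Rmult_assoc, Rinv_l, Rmult_1_r, Rmult_1_l by lra.
apply Rsqr_incrst_0; [|apply Cmod_ge_0|lra]. rewrite !Rsqr_pow2.
pose proof (schwarz_pick_identity (RtoC a) z) as Hid.
replace (Cconj (RtoC a)) with (RtoC a) in Hid
  by (unfold Cconj, RtoC; simpl; rewrite Ropp_0; reflexivity).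
rewrite Hid, Cmod_R, Rabs_pos_eq by lra.
replace (a - z)%C with (- (z - a))%C by ring. rewrite Cmod_opp.
pose proof (Cmod_ge_0 z).
assert (0 < (1 - a ^ 2) * (1 - Cmod z ^ 2)) by (apply Rmult_lt_0_compat; nra).
lra.
Qed.

(** Multiplication by the denominator makes the sum telescope, leaving an explicit remainder that
    tends to 0 in the disk. *)
Lemma disk_automorphism_truncation (a : R) (z : C) (n : nat) :
  ((1 - a * z) * polyval (disk_automorphism_coeff a) n z)%C =
  (a - z + RtoC (1 - a ^ 2) * z * (a * z) ^ n)%C.
Proof.
induction n as [|n IH].
- unfold polyval. rewrite sum_O, RtoC_minus, RtoC_pow. simpl. ring.
- rewrite polyval_S, Cmult_plus_distr_l, IH. unfold disk_automorphism_coeff.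
  rewrite RtoC_opp, RtoC_mult, !Cpow_mult_l, (RtoC_pow a n), !Cpow_S. ring.
Qed.

Lemma disk_automorphism_analytic (a : R) :
  0 <= a < 1 ->
  analytic_in_disk (disk_automorphism a) (disk_automorphism_coeff a).
Proof.
intros Ha z Hz. pose proof (disk_denominator_neq_0 a z Ha Hz) as Hne.
apply is_pseries_polyval.
apply (filterlim_locally_ball_norm (K := C_AbsRing) (U := C_NormedModule)).
intros eps. pose proof (Cmod_ge_0 z) as Hz0.
assert (Hd := proj1 (Cmod_gt_0 _) Hne).
(* The error is compared with [eps] after multiplication by the denominator, hence its modulus in
   the threshold. *)
destruct (pow_lt_1_zero (a * Cmod z)) with (y := eps * Cmod (1 - a * z)) as [N HN].
- rewrite Rabs_pos_eq; nra.
- apply Rmult_lt_0_compat; [apply cond_pos|exact Hd].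
- exists N. intros n Hn. specialize (HN n Hn).
  change (Cmod (polyval (disk_automorphism_coeff a) n z - disk_automorphism a z) < eps).
  apply Rmult_lt_reg_r with (Cmod (1 - a * z)); [exact Hd|].
  rewrite <- Cmod_mult.
  replace ((polyval (disk_automorphism_coeff a) n z - disk_automorphism a z)
    * (1 - a * z))%C with (RtoC (1 - a ^ 2) * z * (a * z) ^ n)%C.
  + rewrite !Cmod_mult, Cmod_pow, Cmod_mult, !Cmod_R.
    rewrite (Rabs_pos_eq a), (Rabs_pos_eq (1 - a ^ 2)) by nra.
    eapply Rle_lt_trans; [|eapply Rle_lt_trans; [apply Rle_abs|exact HN]].
    rewrite <- (Rmult_1_l ((a * Cmod z) ^ n)) at 2.
    apply Rmult_le_compat_r; [apply pow_le|]; nra.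
  + replace ((polyval (disk_automorphism_coeff a) n z - disk_automorphism a z)
      * (1 - a * z))%C with ((1 - a * z) * polyval (disk_automorphism_coeff a) n z
      - disk_automorphism a z * (1 - a * z))%C by ring.
    rewrite disk_automorphism_truncation. unfold disk_automorphism.
    field. exact Hne.
Qed.

Lemma disk_automorphism_bohr_sum (a r : R) :
  0 <= a < 1 -> 0 <= r < 1 ->
  Cmod (disk_automorphism a (- r)) +
    Series (fun k => Cmod (disk_automorphism_coeff a (S k)) * r ^ S k) =
  (a + r) / (1 + a * r) + (1 - a ^ 2) * r / (1 - a * r).
Proof.
intros Ha Hr. assert (Har : 0 <= a * r < 1) by nra. f_equal.
- unfold disk_automorphism.
  replace (a - - r)%C with (RtoC (a + r)) by (rewrite RtoC_plus; ring).
  replace (1 - a * - r)%C with (RtoC (1 + a * r))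
    by (rewrite RtoC_plus, RtoC_mult; ring).
  rewrite <- RtoC_div, Cmod_R by lra. apply Rabs_pos_eq.
  apply Rdiv_le_0_compat; lra.
- rewrite (Series_ext _ (fun k => (1 - a ^ 2) * r * (a * r) ^ k)).
  + rewrite Series_scal_l, Series_geom; [reflexivity|].
    rewrite Rabs_pos_eq; lra.
  + intros k. unfold disk_automorphism_coeff.
    rewrite Cmod_R, Rabs_Ropp, Rabs_pos_eq.
    * rewrite Rpow_mult_distr. simpl. ring.
    * apply Rmult_le_pos; [nra|apply pow_le; lra].
Qed.

Lemma bohr_radius_sharp (a rho : R) :
  0 < a < 1 -> bohr_radius a < 1 -> bohr_radius a < rho ->
  ~ bohr_rogosinski_upto (disk_automorphism a) (disk_automorphism_coeff a) rho.
Proof.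
intros Ha Hr1 Hrho H.
pose proof (bohr_radius_pos a (proj1 Ha)) as Hpos.
pose proof (bohr_radius_root a (proj1 Ha)) as Hroot.
set (r0 := bohr_radius a) in *.
(* Since [rho] may exceed 1, the minimum keeps the test point [- r] inside the disk. Strict growth
   of the quadratic beyond its root [r0] then contradicts the bound. *)
set (r := (r0 + Rmin rho 1) / 2).
assert (Hm : r0 < Rmin rho 1) by (apply Rmin_glb_lt; lra).
pose proof (Rmin_l rho 1). pose proof (Rmin_r rho 1).
assert (Hr : r0 < r < 1 /\ r <= rho) by (unfold r; lra).
assert (Hmod : Cmod (- r) = r) by (rewrite Cmod_opp, Cmod_R, Rabs_pos_eq; lra).
destruct (H (- r)%C) as [_ Hle]; try (rewrite Hmod; lra).
rewrite Hmod, disk_automorphism_bohr_sum in Hle by lra.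
apply bohr_sum_bound_le_1 in Hle; [|lra|lra].
assert (a ^ 2 * r0 ^ 2 <= a ^ 2 * r ^ 2).
{ apply Rmult_le_compat_l; [nra|]. apply pow_incr. lra. }
assert (2 * (1 + a) * r0 < 2 * (1 + a) * r) by (apply Rmult_lt_compat_l; lra).
lra.
Qed.

Theorem theorem2p7 :
  (forall (f : C -> C) (c : nat -> C),
     analytic_in_disk f c -> maps_disk_into_disk f ->
     2 * sqrt 3 - 3 <= Cmod (c 0%nat) ->
     bohr_rogosinski_upto f c (bohr_radius (Cmod (c 0%nat)))) /\
  (forall a : R, 2 * sqrt 3 - 3 <= a < 1 ->
     bohr_radius a = 1 / (sqrt ((1 + a) ^ 2 + a ^ 2) + 1 + a)) /\
  (forall a : R, 2 * sqrt 3 - 3 <= a < 1 ->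
     forall rho : R, bohr_radius a < rho ->
       ~ (forall (f : C -> C) (c : nat -> C),
            analytic_in_disk f c -> maps_disk_into_disk f ->
            Cmod (c 0%nat) = a ->
            bohr_rogosinski_upto f c rho)).
Proof.
pose proof sqrt3_lower as H3. split; [|split].
- exact bohr_rogosinski_upto_radius.
- intros a Ha. apply bohr_radius_rationalized. lra.
- intros a Ha rho Hrho H.
  (* Together with [a < 1] this puts the radius below 1, leaving room in the disk for a larger
     one. *)
  pose proof (bohr_radius_lt a ltac:(lra)) as Hlt.
  apply (bohr_radius_sharp a rho); [lra|lra|exact Hrho|].
  apply H.
  + apply disk_automorphism_analytic. lra.
  + apply disk_automorphism_maps_disk. lra.
  + simpl. rewrite Cmod_R, Rabs_pos_eq; lra.
Qed.
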